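(* Let $S$ be a weak Gaussian semi-local semidomain. Then any invertible ideal of $S$ is principal.
   Context: A semiring is a set $S$ with operations $+,\cdot$ such that $(S,+)$ is a commutative monoid with identity $0$, $(S,\cdot)$ is a commutative monoid with identity $1\neq 0$, multiplication distributes over addition, and $s\cdot 0=0$ for all $s\in S$. An ideal of $S$ is a nonempty subset $I\subseteq S$ such that $a,b\in I$ and $s\in S$ imply $a+b, sa\in I$. An ideal $I$ is subtractive if $a+b\in I$ and $a\in I$ imply $b\in I$ for all $a,b\in S$. An ideal $P\neq S$ is prime if $ab\in P$ implies $a\in P$ or $b\in P$. A semiring is weak Gaussian if each of its prime ideals is subtractive, and semi-local if the set of its maximal ideals (ideals maximal among the ideals $\neq S$) is finite. An element $s\in S$ is multiplicatively cancellable (MC) if $sb=sc$ implies $b=c$ for all $b,c\in S$; $S$ is a semidomain if every nonzero element of $S$ is MC. The total quotient semiring $Q(S)$ is the localization of $S$ at the set $M$ of its MC elements: the set of classes $a/b$ of pairs $(a,b)\in S\times M$ under $(a,b)\sim(c,d)$ iff $tad=tbc$ for some $t\in M$, with $a/b+c/d=(ad+bc)/(bd)$ and $(a/b)(c/d)=(ac)/(bd)$; $S$ is viewed inside $Q(S)$ via $s\mapsto s/1$. A fractional ideal of $S$ is a nonempty subset $I\subseteq Q(S)$ closed under addition and under multiplication by elements of $S$, such that $dI\subseteq S$ for some MC element $d\in S$. The product of fractional ideals is $IJ=\{a_1b_1+\cdots+a_nb_n: a_i\in I,\ b_i\in J\}$. A fractional ideal (in particular an ideal) $I$ of $S$ is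 invertible if $IJ=S$ for some fractional ideal $J$ of $S$. *)

(* Defs.v *)
From HB Require Import structures.
From mathcomp Require Import all_boot all_order all_algebra.
From mathcomp Require Import generic_quotient.
From mathcomp Require Import ring.
From mathcomp Require Import boolp classical_sets cardinality.

Set Implicit Arguments.
Unset Strict Implicit.
Unset Printing Implicit Defensive.

Import GRing.Theory.

Local Open Scope classical_set_scope.
Local Open Scope ring_scope.
Local Open Scope quotient_scope.

(* A semiring in the sense used here (commutative, with 1 != 0) is a
   [comNzSemiRingType]. *)

Section Ideals.
Variable S : comNzSemiRingType.
Implicit Types I P M : set S.

Definition ideal I : Prop :=
  [/\ I !=set0,
      forall a b, I a -> I b -> I (a + b) &
      forall s a, I a -> I (s * a)].

Definition subtractive I : Prop :=
  forall a b, I (a + b) -> I a -> I b.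

Definition prime_ideal P : Prop :=
  [/\ ideal P, P <> setT & forall a b, P (a * b) -> P a \/ P b].

Definition maximal_ideal M : Prop :=
  [/\ ideal M, M <> setT &
      forall I, ideal I -> I <> setT -> M `<=` I -> I = M].

Definition principal I : Prop :=
  exists a : S, I = [set s * a | s in setT].

End Ideals.

Definition weak_gaussian (S : comNzSemiRingType) : Prop :=
  forall P : set S, prime_ideal P -> subtractive P.

Definition semi_local (S : comNzSemiRingType) : Prop :=
  finite_set [set M : set S | maximal_ideal M].

(* Multiplicatively cancellable elements. *)
Definition mc (S : comNzSemiRingType) : set S :=
  [set s | forall b c, s * b = s * c -> b = c].
Arguments mc : clear implicits.

Definition semidomain (S : comNzSemiRingType) : Prop :=
  forall s : S, s != 0 -> mc S s.

Section TotalQuotient.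
Variable S : comNzSemiRingType.

Lemma mc1 : 1 \in mc S.
Proof. by rewrite inE => b c; rewrite !mul1r. Qed.

Lemma mcM (s t : S) : s \in mc S -> t \in mc S -> s * t \in mc S.
Proof.
rewrite !inE => hs ht b c; rewrite -!mulrA => /hs; exact: ht.
Qed.

Record mc_type := Mc { mc_val : S; _ : mc_val \in mc S }.
HB.instance Definition _ := [isSub for mc_val].
HB.instance Definition _ := [Choice of mc_type by <:].

Lemma mc_valP (s : mc_type) : mc_val s \in mc S.
Proof. exact: valP. Qed.

Definition mc_one : mc_type := Mc mc1.
Definition mc_mul (s t : mc_type) : mc_type := Mc (mcM (mc_valP s) (mc_valP t)).

Definition tq_pair : Type := (S * mc_type)%type.
HB.instance Definition _ := Choice.on tq_pair.

Definition tq_rel (x y : tq_pair) : bool :=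
  `[< exists2 t : S, mc S t & t * x.1 * mc_val y.2 = t * mc_val x.2 * y.1 >].

Lemma tq_rel_refl : reflexive tq_rel.
Proof.
move=> x; apply/asboolP; exists 1; first by have := mc1; rewrite inE.
by rewrite !mul1r mulrC.
Qed.

Lemma tq_rel_sym : symmetric tq_rel.
Proof.
suff H x y : tq_rel x y -> tq_rel y x by move=> x y; apply/idP/idP; exact: H.
move=> /asboolP[t ht e]; apply/asboolP; exists t => //.
by rewrite mulrAC -e mulrAC.
Qed.

Lemma tq_rel_trans : transitive tq_rel.
Proof.
move=> y x z /asboolP[t ht e] /asboolP[u hu f]; apply/asboolP.
exists (t * u * mc_val y.2).
  by have /set_mem := mcM (mcM (mem_set ht) (mem_set hu)) (mc_valP y.2).
have -> : t * u * mc_val y.2 * x.1 * mc_val z.2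
        = u * mc_val z.2 * (t * x.1 * mc_val y.2) by ring.
rewrite e.
have -> : u * mc_val z.2 * (t * mc_val x.2 * y.1)
        = t * mc_val x.2 * (u * y.1 * mc_val z.2) by ring.
by rewrite f; ring.
Qed.

Canonical tq_equiv :=
  EquivRel tq_rel tq_rel_refl tq_rel_sym tq_rel_trans.

(* The total quotient semiring Q(S). *)
Definition totq : Type := {eq_quot tq_rel}.
HB.instance Definition _ : EqQuotient _ tq_rel totq := EqQuotient.on totq.
HB.instance Definition _ := Choice.on totq.

Definition tq_frac (a : S) (b : mc_type) : totq := \pi_totq ((a, b) : tq_pair).

Lemma tq_fracP a b c d :
  tq_frac a b = tq_frac c d <->
  exists2 t : S, mc S t & t * a * mc_val d = t * mc_val b * c.
Proof.
split=> [/eqmodP/asboolP //|h]; apply/eqmodP; exact/asboolP.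
Qed.

Lemma tq_fracW (P : totq -> Prop) :
  (forall a b, P (tq_frac a b)) -> forall x, P x.
Proof. by move=> h; elim/quotW=> -[a b]; exact: h. Qed.

(* On representatives; [tq_addE] and [tq_mulE] give the usual formulas. *)
Definition tq_add (x y : totq) : totq :=
  let p : tq_pair := repr x in let q : tq_pair := repr y in
  tq_frac (p.1 * mc_val q.2 + mc_val p.2 * q.1) (mc_mul p.2 q.2).

Definition tq_mul (x y : totq) : totq :=
  let p : tq_pair := repr x in let q : tq_pair := repr y in
  tq_frac (p.1 * q.1) (mc_mul p.2 q.2).

Lemma repr_tq_frac a b : exists2 t : S, mc S t &
  let p : tq_pair := repr (tq_frac a b) in
  t * p.1 * mc_val b = t * mc_val p.2 * a.
Proof.
have : \pi_totq (repr (tq_frac a b)) = tq_frac a b by rewrite reprK.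
by case: (repr _) => c d /= /tq_fracP.
Qed.

Lemma tq_addE a b c d : tq_add (tq_frac a b) (tq_frac c d) =
  tq_frac (a * mc_val d + mc_val b * c) (mc_mul b d).
Proof.
have [t ht e] := repr_tq_frac a b; have [u hu f] := repr_tq_frac c d.
rewrite /tq_add; move: (repr (tq_frac a b)) (repr (tq_frac c d)) e f.
move=> [a' b'] [c' d'] /= e f; apply/tq_fracP; exists (t * u).
  by have /set_mem := mcM (mem_set ht) (mem_set hu).
rewrite /=.
transitivity (u * mc_val d' * mc_val d * (t * a' * mc_val b) +
              t * mc_val b' * mc_val b * (u * c' * mc_val d)); first by ring.
by rewrite e f; ring.
Qed.

Lemma tq_mulE a b c d : tq_mul (tq_frac a b) (tq_frac c d) =
  tq_frac (a * c) (mc_mul b d).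
Proof.
have [t ht e] := repr_tq_frac a b; have [u hu f] := repr_tq_frac c d.
rewrite /tq_mul; move: (repr (tq_frac a b)) (repr (tq_frac c d)) e f.
move=> [a' b'] [c' d'] /= e f; apply/tq_fracP; exists (t * u).
  by have /set_mem := mcM (mem_set ht) (mem_set hu).
rewrite /=.
transitivity ((t * a' * mc_val b) * (u * c' * mc_val d)); first by ring.
by rewrite e f; ring.
Qed.

(* The embedding s |-> s/1 of S into Q(S). *)
Definition to_totq (s : S) : totq := tq_frac s mc_one.

Lemma tq_frac_eq a b c d : a * mc_val d = mc_val b * c -> tq_frac a b = tq_frac c d.
Proof.
move=> e; apply/tq_fracP; exists 1; first by have := mc1; rewrite inE.
by rewrite !mul1r.
Qed.

Lemma tq_addA : associative tq_add.
Proof.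
elim/tq_fracW=> a b; elim/tq_fracW=> c d; elim/tq_fracW=> e f.
by rewrite !tq_addE; apply: tq_frac_eq => /=; ring.
Qed.

Lemma tq_addC : commutative tq_add.
Proof.
elim/tq_fracW=> a b; elim/tq_fracW=> c d.
by rewrite !tq_addE; apply: tq_frac_eq => /=; ring.
Qed.

Lemma tq_add0 : left_id (to_totq 0) tq_add.
Proof.
by elim/tq_fracW=> a b; rewrite !tq_addE; apply: tq_frac_eq => /=; ring.
Qed.

HB.instance Definition _ := GRing.isNmodule.Build totq tq_addA tq_addC tq_add0.

Lemma tq_mulA : associative tq_mul.
Proof.
elim/tq_fracW=> a b; elim/tq_fracW=> c d; elim/tq_fracW=> e f.
by rewrite !tq_mulE; apply: tq_frac_eq => /=; ring.
Qed.

Lemma tq_mulC : commutative tq_mul.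
Proof.
elim/tq_fracW=> a b; elim/tq_fracW=> c d.
by rewrite !tq_mulE; apply: tq_frac_eq => /=; ring.
Qed.

Lemma tq_mul1 : left_id (to_totq 1) tq_mul.
Proof.
by elim/tq_fracW=> a b; rewrite !tq_mulE; apply: tq_frac_eq => /=; ring.
Qed.

Lemma tq_mulDl : left_distributive tq_mul tq_add.
Proof.
elim/tq_fracW=> a b; elim/tq_fracW=> c d; elim/tq_fracW=> e f.
by rewrite !(tq_mulE, tq_addE); apply: tq_frac_eq => /=; ring.
Qed.

Lemma tq_mul0 : left_zero (to_totq 0) tq_mul.
Proof.
by elim/tq_fracW=> a b; rewrite !tq_mulE; apply: tq_frac_eq => /=; ring.
Qed.

Lemma to_totq_inj : injective to_totq.
Proof.
move=> a b /tq_fracP[t ht] /=; rewrite !mulr1; exact: ht.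
Qed.

Lemma tq_1neq0 : to_totq 1 != to_totq 0.
Proof. by rewrite (inj_eq to_totq_inj) oner_neq0. Qed.

HB.instance Definition _ := GRing.Nmodule_isComNzSemiRing.Build totq
  tq_mulA tq_mulC tq_mul1 tq_mulDl tq_mul0 tq_1neq0.

Lemma tq_fracD a b c d :
  tq_frac a b + tq_frac c d = tq_frac (a * mc_val d + mc_val b * c) (mc_mul b d).
Proof. exact: tq_addE. Qed.

Lemma tq_fracM a b c d :
  tq_frac a b * tq_frac c d = tq_frac (a * c) (mc_mul b d).
Proof. exact: tq_mulE. Qed.

Lemma to_totqD : {morph to_totq : a b / a + b}.
Proof. by move=> a b; rewrite tq_fracD; apply: tq_frac_eq => /=; ring. Qed.

Lemma to_totqM : {morph to_totq : a b / a * b}.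
Proof. by move=> a b; rewrite tq_fracM; apply: tq_frac_eq => /=; ring. Qed.

Definition fractional_ideal (I : set totq) : Prop :=
  [/\ I !=set0,
      forall x y, I x -> I y -> I (x + y),
      forall s x, I x -> I (to_totq s * x) &
      exists2 d : S, mc S d &
        [set to_totq d * x | x in I] `<=` range to_totq].

Definition frac_prod (I J : set totq) : set totq :=
  [set z | exists n (a b : 'I_n.+1 -> totq),
     [/\ forall i, I (a i), forall i, J (b i) & z = \sum_i a i * b i]].

Definition frac_invertible (I : set totq) : Prop :=
  exists2 J, fractional_ideal J & frac_prod I J = range to_totq.

Definition invertible_ideal (I : set S) : Prop :=
  frac_invertible (to_totq @` I).

End TotalQuotient.

(* Main.v *)
Require Import Defs.
From mathcomp Require Import all_boot all_order all_algebra.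
From mathcomp Require Import boolp classical_sets cardinality.

(** Let [J] be an inverse of [I], so that [I J = S], and let [m_1, ..., m_n] be
    the maximal ideals of [S].  It suffices to find a single [w] in [J] such
    that the ideal [w I] of [S] lies in none of the [m_i]: by Zorn's lemma
    ([proper_ideal_sub_maximal]) then [w I = S], so [1 = w a] for some [a] in
    [I], and every [x] in [I] equals [(w x) a] with [w x] in [S]; hence
    [I = S a].

    For one maximal ideal [m], such a [w] exists because otherwise all products
    of elements of [I] and [J], and therefore [1], would lie in [m].  The
    local choices are glued one maximal ideal at a time
    ([exists_multiple_avoiding]).  Suppose [w] works for [m_1, ..., m_k], but
    [w I] is contained in [m = m_(k+1)].  Choose [b] in [J] with [b I] not in
    [m], and [u] in [m_1], ..., [m_k] but not in [m]; such a [u] exists because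
    [m] is prime and contains no other maximal ideal
    ([prime_ideal_separation]).  Then [w + u b] works for all
    [k + 1] ideals: at each of them, on a suitable element of [I], exactly one
    of the two summands takes a value outside the ideal.  In a ring this is
    immediate; in a semiring the conclusion that [x + y] is outside [m] when [x] is inside and [y] is
    outside says precisely that [m] is subtractive, which holds because maximal
    ideals are prime and [S] is weak Gaussian. *)

Set Implicit Arguments.
Unset Strict Implicit.
Unset Printing Implicit Defensive.

Import GRing.Theory.

Local Open Scope classical_set_scope.
Local Open Scope ring_scope.

Section IdealTheory.
Variable S : comNzSemiRingType.
Implicit Types (I P M N : set S) (a b c u x : S).

Lemma ideal_properP I : ideal I -> I <> setT <-> ~ I 1.
Proof.
move=> [_ _ IM]; split=> [IT I1|nI1 IT]; last by apply: nI1; rewrite IT.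
by apply: IT; apply/seteqP; split=> // a _; rewrite -[a]mulr1; exact: IM.
Qed.

Lemma ideal0 I : ideal I -> I 0.
Proof. by move=> [[a Ia] _ IM]; rewrite -(mul0r a); exact: IM. Qed.

Lemma ideal_adjoin M a : ideal M ->
  ideal [set x | exists m s, M m /\ x = m + s * a].
Proof.
move=> hM; have [_ MD MM] := hM; split.
- by exists 0, 0, 0; split; [exact: ideal0 | rewrite mul0r addr0].
- move=> _ _ [m [s [Mm ->]]] [n [t [Mn ->]]]; exists (m + n), (s + t).
  by split; [exact: MD | rewrite mulrDl addrACA].
- move=> r _ [m [s [Mm ->]]]; exists (r * m), (r * s).
  by split; [exact: MM | rewrite mulrDr mulrA].
Qed.

(** If [M] is maximal and misses [a], then [1 = m + s a] with [m] in [M];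
    multiplying by [b] puts [b] in [M] as soon as [a b] is. *)
Lemma maximal_ideal_prime M : maximal_ideal M -> prime_ideal M.
Proof.
move=> [hM MT Mmax]; split=> // a b Mab.
have [_ MD MM] := hM.
have [|nMa] := pselect (M a); [by left | right].
have hN := ideal_adjoin a hM.
set N := [set x | _] in hN.
have [m [s [Mm e]]] : N 1.
  apply: contrapT => /(ideal_properP hN) NT.
  apply: nMa; rewrite -(Mmax N hN NT).
    by exists 0, 1; split; [exact: ideal0 | rewrite mul1r add0r].
  by move=> x Mx; exists x, 0; split=> //; rewrite mul0r addr0.
rewrite -[b]mul1r e mulrDl; apply: MD; first by rewrite mulrC; exact: MM.
by rewrite -mulrA; exact: MM.
Qed.

(** Zorn's lemma applied to the sets [X] such that [I `|` X] is a proper ideal: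
    this parametrization makes the union of the empty chain admissible. *)
Lemma proper_ideal_sub_maximal I : ideal I -> I <> setT ->
  exists2 M, maximal_ideal M & I `<=` M.
Proof.
move=> hI IT; have nI1 := (ideal_properP hI).1 IT.
pose P : set (set S) := [set X | ideal (I `|` X) /\ ~ (I `|` X) 1].
have [F FP Ftot|A [[hA nA1] Amax]] := @Zorn_bigcup S P.
  set U := \bigcup_(X in F) X.
  (* Any two elements of the union already lie in one member of the chain. *)
  have common a b : (I `|` U) a -> (I `|` U) b -> exists X,
      [/\ ideal (I `|` X), I `|` X `<=` I `|` U, (I `|` X) a & (I `|` X) b].
    have sub X : F X -> I `|` X `<=` I `|` U.
      by move=> FX; apply: setUS => x Xx; exists X.
    have idF X : F X -> ideal (I `|` X) by move=> /FP[].
    move=> [Ia|[X FX Xa]] [Ib|[Y FY Yb]].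
    - by exists set0; rewrite setU0; split=> // x; left.
    - by exists Y; split; [exact: idF | exact: sub | left | right].
    - by exists X; split; [exact: idF | exact: sub | right | left].
    - have [XY|YX] := Ftot _ _ FX FY.
      + by exists Y; split; [exact: idF | exact: sub | right; exact: XY | right].
      + by exists X; split; [exact: idF | exact: sub | right | right; exact: YX].
  split.
    split.
    + by have [[x Ix] _ _] := hI; exists x; left.
    + move=> a b Ua Ub; have [X [[_ XD _] XU Xa Xb]] := common _ _ Ua Ub.
      by apply: XU; exact: XD.
    + move=> s a Ua; have [X [[_ _ XM] XU Xa _]] := common _ _ Ua Ua.
      by apply: XU; exact: XM.
  by move=> [//|[X FX X1]]; have [_] := FP _ FX; apply; right.
exists (I `|` A); last by move=> x; left.
split=> //; first exact/(ideal_properP hA).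
move=> B hB BT AB.
have IB : I `|` B = B by apply/setUidPr => x Ix; apply: AB; left.
apply/seteqP; split=> // x Bx; right.
apply: contrapT => nAx; apply: (Amax B).
  by split=> [y Ay|BA]; [apply: AB; right | exact/nAx/BA].
by rewrite /P/mkset IB; split=> //; exact/(ideal_properP hB).
Qed.

(** The product of one element of [N] outside [P] for each [N] is in all the
    [N], and outside [P] because [P] is prime. *)
Lemma prime_ideal_separation P (s : seq (set S)) : prime_ideal P ->
  (forall N, N \in s -> ideal N /\ ~ N `<=` P) ->
  exists2 u, forall N, N \in s -> N u & ~ P u.
Proof.
move=> [hP PT Pprime]; elim: s => [_|N s IHs hs].
  by exists 1 => //; exact/(ideal_properP hP).
have [N' N's|u su nPu] := IHs; first by apply: hs; rewrite inE N's orbT.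
have [[_ _ NM] /existsNP[y /not_implyP[Ny nPy]]] := hs N (mem_head _ _).
exists (y * u); last by move=> /Pprime[].
move=> N'; rewrite inE => /predU1P[->|N's]; first by rewrite mulrC; exact: NM.
have [|[_ _ N'M] _] := hs N'; first by rewrite inE N's orbT.
by apply: N'M; exact: su.
Qed.

End IdealTheory.

Section Multiples.
Variable S : comNzSemiRingType.
Implicit Types (I M : set S) (w v : totq S).

(** The part of [w I] inside [S], as a set of elements of [S]. *)
Definition totq_multiple w I : set S :=
  [set c | exists2 x, I x & to_totq c = w * to_totq x].

Lemma ideal_totq_multiple w I : ideal I -> ideal (totq_multiple w I).
Proof.
move=> hI; have [_ ID IM] := hI; split.
- exists 0, 0; first exact: ideal0.
  by rewrite [RHS]mulr0.
- move=> a b [x Ix ex] [y Iy ey]; exists (x + y); first exact: ID.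
  by rewrite !to_totqD ex ey mulrDr.
- move=> s a [x Ix ex]; exists (s * x); first exact: IM.
  by rewrite !to_totqM ex mulrCA.
Qed.

(** An element of [J] that works for all ideals of [s] but fails for [M] is
    corrected by adding [u b], where [b] works for [M] and [u] is in all the
    ideals of [s] but not in [M]; subtractivity keeps the sums outside. *)
Lemma exists_multiple_avoiding I (J : set (totq S)) (s : seq (set S)) :
  J !=set0 ->
  (forall w v, J w -> J v -> J (w + v)) ->
  (forall a w, J w -> J (to_totq a * w)) ->
  (forall w x, J w -> I x -> range (@to_totq S) (w * to_totq x)) ->
  uniq s ->
  (forall M, M \in s -> [/\ maximal_ideal M, subtractive M &
    exists2 w, J w & ~ totq_multiple w I `<=` M]) ->
  exists2 w, J w & forall M, M \in s -> ~ totq_multiple w I `<=` M.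
Proof.
move=> J0 JD JM JI; elim: s => [_ _|M s IHs /= /andP[Ms us] hs].
  by case: J0 => w Jw; exists w.
have [//|N Ns|w Jw ws] := IHs; first by apply: hs; rewrite inE Ns orbT.
have [wM|nwM] := pselect (totq_multiple w I `<=` M); last first.
  by exists w => // N; rewrite inE => /predU1P[->|/ws].
have [maxM subM [b Jb /existsNP[c /not_implyP[[x Ix ec] nMc]]]] :=
  hs M (mem_head _ _).
have [idM MT maxM'] := maxM.
have primeM := maximal_ideal_prime maxM.
have [N Ns|u su nMu] := @prime_ideal_separation S M s primeM.
  have [|[idN _ maxN] _ _] := hs N; first by rewrite inE Ns orbT.
  by split=> // NM; move: Ms; rewrite (maxN _ idM MT NM) Ns.
exists (w + to_totq u * b); first by apply: JD => //; exact: JM.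
(* Evaluating at [z] gives a term of [w I] plus [u] times a term of [b I]. *)
have sum_multiple z p q : I z -> to_totq p = w * to_totq z ->
    to_totq q = b * to_totq z ->
    totq_multiple (w + to_totq u * b) I (p + u * q).
  by move=> Iz ep eq_; exists z => //; rewrite to_totqD to_totqM ep eq_ mulrDl mulrA.
move=> N; rewrite inE => /predU1P[-> wubM|Ns wubN].
- have [p _ ep] := JI _ _ Jw Ix.
  have Mp : M p by apply: wM; exists x.
  have /subM/(_ Mp) : M (p + u * c) by exact/wubM/(sum_multiple x).
  by have [_ _ /[apply] -[]] := primeM.
- have [|[[_ _ NM] _ _] subN _] := hs N; first by rewrite inE Ns orbT.
  apply: (ws N Ns) => p [z Iz ep].
  have [q _ eq_] := JI _ _ Jb Iz.
  have Nuq : N (u * q) by rewrite mulrC; apply: NM; exact: su.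
  apply: subN Nuq; rewrite addrC.
  exact/wubN/(sum_multiple z).
Qed.

End Multiples.

Theorem theorem2p6 (S : comNzSemiRingType)
    (hWG : weak_gaussian S) (hSL : semi_local S) (hSD : semidomain S)
    (I : set S) (hI : ideal I) (hinv : invertible_ideal I) :
  principal I.
Proof.
have [J [J0 JD JM _] IJ] := hinv.
have JI w x : J w -> I x -> range (@to_totq S) (w * to_totq x).
  move=> Jw Ix; rewrite -IJ; exists 0%N, (fun=> to_totq x), (fun=> w).
  by split=> [_|//|]; [exists x | rewrite big_ord1 mulrC].
have [n [a [b [Ia Jb e1]]]] : frac_prod (@to_totq S @` I) J (to_totq 1).
  by rewrite IJ; exists 1.
have local M : maximal_ideal M -> exists2 w, J w & ~ totq_multiple w I `<=` M.
  move=> maxM; have [idM MT _] := maxM; have [_ MD _] := idM.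
  have nM1 := (ideal_properP idM).1 MT.
  apply: contrapT => noW; apply: nM1.
  have sumM : exists2 c, M c & to_totq c = \sum_i a i * b i.
    elim/big_ind: _ => [|_ _ [c Mc <-] [d Md <-]|i _].
    - by exists 0; [exact: ideal0 | ].
    - by exists (c + d); [exact: MD | rewrite to_totqD].
    - have [x Ix <-] := Ia i; have [c _ ec] := JI _ _ (Jb i) Ix.
      exists c; last by rewrite ec mulrC.
      apply: contrapT => nMc; apply: noW; exists (b i) => // biM.
      by apply/nMc/biM; exists x.
  have [c Mc ec] := sumM.
  by rewrite (_ : 1 = c) //; apply: to_totq_inj; rewrite ec.
have [s es] := (finite_seqP _).1 hSL.
have mem_s M : M \in undup s <-> maximal_ideal M.
  by rewrite mem_undup; have /= <- := congr1 (fun A : set (set S) => A M) es.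
have [M /mem_s maxM|w Jw ws] :=
    exists_multiple_avoiding J0 JD JM JI (undup_uniq s).
  by split=> //; [exact: hWG _ (maximal_ideal_prime maxM) | exact: local].
have [x Ix ex] : totq_multiple w I 1.
  have idw := ideal_totq_multiple w hI.
  apply: contrapT => /(ideal_properP idw) wT.
  have [M /mem_s Ms wM] := proper_ideal_sub_maximal idw wT.
  exact: ws Ms wM.
exists x; apply/seteqP; split=> [y Iy|_ [c _ <-]]; last first.
  by have [_ _ IM] := hI; exact: IM.
have [c _ ec] := JI _ _ Jw Iy; exists c => //.
apply: to_totq_inj; rewrite to_totqM ec mulrAC -ex.
by rewrite -to_totqM mul1r.
Qed.
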